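(* Let $V$ be a finite-dimensional vector space over $\mathrm{GF}(2)$, let $\rho$ be a permutation of $V$, and let $G = \langle\, \rho\sigma_k : k \in V \,\rangle \le \mathrm{Sym}(V)$. If $G$ acts imprimitively on $V$, then there is a linear subspace $U$ of $V$ with $U \ne \{0\}$ and $U \neq V$ such that for all $v \in V$ and $u \in U$, $$(v+u)\rho + v\rho \in U .$$ Conversely, if there is a linear subspace $U \neq \{0\}, V$ of $V$ such that $(v+u)\rho + v\rho \in U$ for all $v \in V$ and $u \in U$, then $G$ acts imprimitively on $V$.
   Context: Maps are written on the right and composed left to right. For $k \in V$, $\sigma_k : V \to V$ is the translation $w \mapsto w + k$. The permutations $\rho\sigma_k$ are the round functions of a key-alternating block cipher with message space $V$, and $G$ is the group they generate (it contains all translations, hence is transitive on $V$). A partition $\mathcal{B}$ of $V$ is $G$-invariant if $Bg \in \mathcal{B}$ for all $B \in \mathcal{B}$, $g \in G$; it is trivial if $\mathcal{B} = \{V\}$ or $\mathcal{B} = \{\{\alpha\} : \alpha \in V\}$. $G$ acts imprimitively on $V$ if there is a non-trivial $G$-invariant partition of $V$, and is primitive otherwise. *)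

(* Defs.v *)
From HB Require Import structures.
From mathcomp Require Import all_boot all_order all_algebra all_fingroup.
From mathcomp Require Import all_solvable all_field.

Set Implicit Arguments.
Unset Strict Implicit.
Unset Printing Implicit Defensive.

Import GRing.Theory.

Section Imprimitivity.

Variable T : finType.
Implicit Types (G : {set {perm T}}) (P : {set {set T}}).

Definition invariant_partition G P : bool :=
  partition P [set: T] &&
  [forall g in G, forall B in P, [set g x | x in B] \in P].

Definition trivial_partition P : bool :=
  (P == [set [set: T]]) || (P == [set [set a] | a : T]).

Definition imprimitive G : bool :=
  [exists P, invariant_partition G P && ~~ trivial_partition P].

Lemma invariant_partitionE G P :
  invariant_partition G P =
  partition P [set: T] && [acts G, on P | ('P^*)%act].
Proof.
congr (_ && _); apply/forall_inP/subsetP => [inv g Gg | acts g Gg].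
  rewrite !inE; apply/subsetP => B PB; rewrite inE /=.
  by have /forall_inP/(_ B PB) := inv g Gg.
apply/forall_inP => B PB; have := acts g Gg.
by rewrite !inE => /subsetP/(_ B PB); rewrite inE.
Qed.

Lemma trivial_partitionE P : partition P [set: T] ->
  ~~ trivial_partition P = (1 < #|P| < #|[set: T]|).
Proof.
move=> partP; have [/eqP covP _ P0] := and3P partP.
have P_gt0 A : A \in P -> 0 < #|A|.
  by move=> PA; rewrite card_gt0; apply: contraNneq P0 => <-.
have leP : \sum_(A in P) 1 <= \sum_(A in P) #|A|
             ?= iff [forall (A | A \in P), 1 == #|A|].
  apply: leqif_sum => A PA; split; [exact: P_gt0 | by []].
rewrite -(card_partition partP) sum1_card in leP.
rewrite [#|P| < _]ltn_neqAle !leP andbT negb_or.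
have -> : [forall (A | A \in P), 1 == #|A|] = (P == [set [set a] | a : T]).
  apply/forall_inP/eqP => [sing | -> _ /imsetP[a _ ->]]; last by rewrite cards1.
  apply/setP => A; apply/idP/imsetP => [/sing | [a _ ->]].
    by rewrite eq_sym => /cards1P[a ->]; exists a.
  have: a \in cover P by rewrite covP inE.
  case/bigcupP => B PB aB; have := sing B PB.
  rewrite eq_sym => /cards1P[b defB].
  by move: aB PB; rewrite defB inE => /eqP->.
case: (P =P [set [set a] | a : T]) => [_ | nsing]; rewrite ?andbF // !andbT.
rewrite ltn_neqAle card_gt0; have [P00 | _] /= := eqVneq P set0.
  case: nsing; apply/setP => A; rewrite P00 inE; apply/esym/imsetP => -[a _ _].
  by have: a \in cover P by [rewrite covP inE]; rewrite P00 /cover big_set0 inE.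
rewrite andbT; congr (~~ _); rewrite [RHS]eq_sym; apply/eqP/cards1P => [-> | [A defP]].
  by exists setT.
by rewrite defP -covP defP /cover big_set1.
Qed.

Lemma imprimitiveE G :
  imprimitive G = [exists P, imprimitivity_system G [set: T] 'P P].
Proof.
apply: eq_existsb => P; rewrite invariant_partitionE /imprimitivity_system.
by rewrite -andbA; case partP: (partition P _); rewrite //= trivial_partitionE.
Qed.

End Imprimitivity.

(* [finvect_type V] is [V] itself, with the finiteness that [V] inherits from  *)
(* its base field; permutations act on the right: [(s * t) x = t (s x)].       *)
Section RoundFunctions.

Variable V : vectType 'F_2.
Local Notation fV := (finvect_type V).

Definition translation (k : fV) : {perm fV} := perm (addIr k).

Definition round_group (rho : {perm fV}) : {group {perm fV}} :=
  <<[set (rho * translation k)%g | k : fV]>>%G.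

End RoundFunctions.

(* Main.v *)
Require Import Defs.
From mathcomp Require Import all_boot all_order all_algebra all_fingroup.
From mathcomp Require Import all_solvable all_field.

(** The group generated by the round functions is generated by [rho] together
    with all translations ([mem_round_group_rho], [mem_round_group_translation]),
    so an invariant partition is in particular one that is invariant under
    translations.  Such a partition is the coset partition of its block [U] at
    [0], and [U] is an additive subgroup, hence a subspace because the field is
    GF(2) ([addr_closed_vspace]).  The partition into cosets of [U] is moreover
    stable under [rho] exactly when [rho] sends [v + U] to [rho v + U] for each
    [v], which is the displayed condition since subtraction and addition agree
    in characteristic 2.  Non-triviality of the partition corresponds to [U]
    being neither [0] nor the full space. *)

Import GRing.Theory.
Local Open Scope ring_scope.

Section InvariantBlocks.

Context {T : finType} {G : {set {perm T}}} {P : {set {set T}}}.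
Hypothesis invP : invariant_partition G P.

Lemma invariant_partition_cover x : x \in cover P.
Proof. by have /andP[/and3P[/eqP-> _ _] _] := invP; rewrite inE. Qed.

Lemma invariant_pblock g x y : g \in G ->
  (g y \in pblock P (g x)) = (y \in pblock P x).
Proof.
move=> Gg; have /andP[/and3P[_ tiP _] /forall_inP/(_ g Gg)/forall_inP invg] := invP.
have PBx : pblock P x \in P by rewrite pblock_mem ?invariant_partition_cover.
have xB : x \in pblock P x by rewrite mem_pblock invariant_partition_cover.
rewrite (def_pblock (x := g x) tiP (invg _ PBx)); last exact: imset_f.
by rewrite mem_imset //; apply: perm_inj.
Qed.

(** Transitivity carries a singleton block onto every other block, so one such
    block would make the whole partition discrete; a block equal to the whole
    set leaves no room for a second one. *)
Lemma pblock_nontrivial x : (forall y, exists2 g, g \in G & g x = y) ->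
  ~~ trivial_partition P ->
  pblock P x != [set x] /\ pblock P x != [set: T].
Proof.
move=> transG; rewrite negb_or => /andP[nfull nsing].
have /andP[/and3P[_ tiP P0] _] := invP.
have blockP B : B \in P -> exists2 y, y \in B & B = pblock P y.
  move=> PB; have [B0 | [y By]] := set_0Vmem B; first by rewrite -B0 PB in P0.
  by exists y => //; rewrite (def_pblock tiP PB By).
have pblockP y : pblock P y \in P.
  by rewrite pblock_mem ?invariant_partition_cover.
split; apply/eqP => defB.
  have sing y : pblock P y = [set y].
    have [g Gg <-] := transG y; apply/setP=> z.
    by rewrite -(permKV g z) invariant_pblock // defB !inE (inj_eq perm_inj).
  case/eqP: nsing; apply/setP=> B; apply/idP/imsetP=> [/blockP[y _ ->] | [y _ ->]].
    by exists y; rewrite ?sing.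
  by rewrite -sing pblockP.
case/eqP: nfull; apply/setP=> B; rewrite inE; apply/idP/eqP=> [/blockP[y _ ->] | ->].
  by rewrite -defB; apply: (same_pblock tiP); rewrite defB inE.
by rewrite -defB pblockP.
Qed.

End InvariantBlocks.

Section BinarySpaces.

Variable V : vectType 'F_2.
Local Notation fV := (finvect_type V).

Lemma subrE_F2 (x y : fV) : x - y = x + y.
Proof.
by congr (_ + _); rewrite -scaleN1r (_ : -1 = 1 :> 'F_2) ?scale1r //; apply/val_inj.
Qed.

(** The only scalars are [0] and [1], so closure under addition already gives
    closure under linear combinations. *)
Lemma addr_closed_vspace (A : {set fV}) : 0 \in A ->
    (forall x y, x \in A -> y \in A -> x + y \in A) ->
  {U : {vspace fV} | forall x, (x \in U) = (x \in A)}.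
Proof.
move=> A0 AD; exists <<enum A>>%VS => x; apply/idP/idP=> [Ux | Ax].
  rewrite (coord_span (X := in_tuple (enum A)) Ux).
  elim/big_ind: _ => // i _; set a := coord _ _ _.
  have [->|a_nz] := eqVneq a 0; first by rewrite scale0r.
  have -> : a = 1 by apply/val_inj; case: a a_nz => [[|[|[]]]].
  by rewrite scale1r -mem_enum mem_nth.
by apply: memv_span; rewrite mem_enum.
Qed.

Variable rho : {perm fV}.

Lemma translationE (k x : fV) : translation k x = x + k.
Proof. by rewrite permE. Qed.

Lemma translation0 : translation (0 : fV) = 1%g.
Proof. by apply/permP=> x; rewrite translationE perm1 addr0. Qed.

Lemma mem_round_group_rho : rho \in round_group rho.
Proof.
by apply/mem_gen/imsetP; exists 0; rewrite ?translation0 ?mulg1.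
Qed.

(** [rho] is itself the round function of key [0], so cancelling it from the
    round function of key [k] leaves the translation by [k]. *)
Lemma mem_round_group_translation (k : fV) : translation k \in round_group rho.
Proof.
rewrite -(groupMl _ mem_round_group_rho).
by apply/mem_gen/imsetP; exists k.
Qed.

Lemma imprimitive_subspace : imprimitive (round_group rho) ->
  exists U : {vspace fV},
    [/\ U <> 0%VS, U <> fullv &
        forall v u : fV, u \in U -> rho (v + u) + rho v \in U].
Proof.
case/existsP=> P /andP[invP ntP].
have /andP[/and3P[_ tiP _] _] := invP.
have xB x : x \in pblock P x.
  by rewrite mem_pblock (invariant_partition_cover invP).
have shiftB (k x y : fV) : (y + k \in pblock P (x + k)) = (y \in pblock P x).
  rewrite -!translationE (invariant_pblock invP) //.
  exact: mem_round_group_translation.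
(* Every block is a translate of the block at the origin. *)
have cosetB x y : (y \in pblock P x) = (y - x \in pblock P 0).
  by rewrite -(shiftB (- x)) subrr.
have [|x y Ux Uy|U memU] := @addr_closed_vspace (pblock P 0); first exact: xB.
  by rewrite -(same_pblock tiP Uy) cosetB addrK.
have [y|nB0 nBT] := pblock_nontrivial invP 0 _ ntP.
  exists (translation y); first exact: mem_round_group_translation.
  by rewrite translationE add0r.
exists U; split=> [U0|UT|v u].
- by case/eqP: nB0; apply/setP=> x; rewrite -memU U0 memv0 inE.
- by case/eqP: nBT; apply/setP=> x; rewrite -memU UT memvf inE.
rewrite !memU -subrE_F2 -cosetB (invariant_pblock invP) ?mem_round_group_rho //.
by rewrite cosetB addrC addKr.
Qed.

(** The partition is the one into cosets of [U].  Invariance need only be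
    tested on the generators, because the permutations that stabilise a
    partition form a group. *)
Lemma subspace_imprimitive (U : {vspace fV}) : U <> 0%VS -> U <> fullv ->
    (forall v u : fV, u \in U -> rho (v + u) + rho v \in U) ->
  imprimitive (round_group rho).
Proof.
move=> nU0 nUT stabU.
pose R := [rel x y : fV | y - x \in U].
pose coset x := [set y | R x y].
pose P := equivalence_partition R [set: fV].
have cosetP x : coset x \in P.
  apply/imsetP; exists x; rewrite ?inE //.
  by apply/setP=> y; rewrite !inE.
have coset0 x : (x \in coset 0) = (x \in U) by rewrite inE /= subr0.
have partP : partition P [set: fV].
  apply: equivalence_partitionP => x y z _ _ _ /=; rewrite subrr mem0v; split=> // Uxy.
  by rewrite -[z - x](subrKA y) addrC rpredDl.
apply/existsP; exists P; rewrite invariant_partitionE partP /=; apply/andP; split.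
  rewrite gen_subG; apply/subsetP=> _ /imsetP[k _ ->].
  rewrite !inE; apply/subsetP=> _ /imsetP[x _ ->]; rewrite inE /=.
  set g := (rho * _)%g.
  suff -> : setact 'P [set y in [set: fV] | R x y] g = coset (g x) by [].
  (* Cosets all have the size of [U], so mapping into a coset is mapping onto. *)
  have cardC z : #|coset z| = #|U|.
    rewrite -[RHS](card_imset _ (addIr z)); apply: eq_card => y; rewrite inE /=.
    apply/idP/imsetP=> [Uy | [u Uu ->]]; last by rewrite addrK.
    by exists (y - z); rewrite ?subrK.
  apply/eqP; rewrite eqEcard; apply/andP; split.
    apply/subsetP=> _ /imsetP[y Uy ->]; move: Uy; rewrite !inE /= => Uy.
    rewrite /aperm !permM !translationE opprD addrACA subrr addr0 subrE_F2.
    by have := stabU x _ Uy; rewrite [x + _]addrC subrK.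
  rewrite card_setact cardC -(cardC x); apply: subset_leq_card.
  by apply/subsetP=> y; rewrite !inE.
rewrite negb_or; apply/andP; split; apply/eqP => defP; have := cosetP 0; rewrite defP.
  rewrite inE => /eqP defU; case: nUT; apply/vspaceP=> x.
  by rewrite -coset0 defU inE memvf.
case/imsetP=> a _ defU; case: nU0; apply/vspaceP=> x.
have := coset0 0; rewrite defU inE mem0v => /eqP a0.
by rewrite -coset0 defU -a0 inE memv0.
Qed.

End BinarySpaces.

Theorem corollary4p1 (V : vectType 'F_2) (rho : {perm (finvect_type V)}) :
  (imprimitive (round_group rho) ->
     exists U : {vspace (finvect_type V)},
       [/\ U <> 0%VS, U <> fullv &
           forall v u : finvect_type V,
             u \in U -> (rho (v + u) + rho v)%R \in U]) /\
  ((exists U : {vspace (finvect_type V)},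
       [/\ U <> 0%VS, U <> fullv &
           forall v u : finvect_type V,
             u \in U -> (rho (v + u) + rho v)%R \in U]) ->
     imprimitive (round_group rho)).
Proof.
split; first exact: imprimitive_subspace.
by case=> U [nU0 nUT stabU]; apply: subspace_imprimitive stabU.
Qed.
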